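(* Let $k$ be a local field (complete with respect to a discrete valuation $v$, with finite residue field), with ring of integers $\mathcal{O}$. Let $F(x)\in\mathcal{O}[x]$ be a monic irreducible separable polynomial of degree $n$, $\theta$ a root of $F$ in a separable closure of $k$, and $L=k(\theta)$. Let $e=e(L/k)$ and $f=f(L/k)$ be the ramification index and residual degree, let $\mu(F)$ be as defined below, and let $\rho\ge 0$ be the integer such that $\operatorname{Diff}(L/k)=\mathfrak{m}_L^{\,e-1+\rho}$. Then $$v(\operatorname{Disc}(F))=f\,(e\,\mu(F)+\rho)=n\,\mu(F)+f\rho .$$
   Context: $v$ denotes the canonical extension of the valuation of $k$ to an algebraic closure $\overline{k}$, normalized by $v(k^* )=\mathbb{Z}$. $\mathcal{O}_L$ is the ring of integers of $L$ and $\mathfrak{m}_L$ its maximal ideal; $\operatorname{Diff}(L/k)$ is the different ideal of $L/k$. $\operatorname{Disc}(F)$ is the discriminant of the polynomial $F$. The invariant $\mu(F)$ is defined as $\mu(F):=\max\{v(g(\theta)) : g(x)\in\mathcal{O}[x] \text{ monic}, \ \deg g<n\}$. *)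

(* Defs.v *)
From HB Require Import structures.
From mathcomp Require Import all_boot all_order all_algebra all_field.
From mathcomp Require Import boolp classical_sets.

Set Implicit Arguments.
Unset Strict Implicit.
Unset Printing Implicit Defensive.

Import Order.TTheory GRing.Theory Num.Theory.
Local Open Scope ring_scope.
Local Open Scope classical_set_scope.

Section Valuations.
Variables (K : fieldType) (G : realDomainType).

(* A valuation is given by its values on K^*; by convention v(0) = +oo, so the
   element v 0 : G is meaningless and is never used. *)
Definition is_valuation (v : K -> G) : Prop :=
  (forall x y, x != 0 -> y != 0 -> v (x * y) = v x + v y) /\
  (forall x y, x != 0 -> y != 0 -> x + y != 0 ->
     Num.min (v x) (v y) <= v (x + y)).

Definition val_ge (v : K -> G) (c : G) : {pred K} :=
  [pred x | (x == 0) || (c <= v x)].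

Definition val_gt (v : K -> G) (c : G) : {pred K} :=
  [pred x | (x == 0) || (c < v x)].

Definition int_ring (v : K -> G) : {pred K} := val_ge v 0.

Definition max_ideal (v : K -> G) : {pred K} := val_gt v 0.

Definition val_complete (v : K -> G) : Prop :=
  forall u : nat -> K,
    (forall c, exists N, forall i j, (N <= i)%N -> (N <= j)%N ->
       u i - u j \in val_ge v c) ->
  exists l, forall c, exists N, forall i, (N <= i)%N -> u i - l \in val_ge v c.

Definition finite_residue_field (v : K -> G) : Prop :=
  exists s : seq K, forall x, x \in int_ring v ->
    exists2 y, y \in s & (y \in int_ring v) && (x - y \in max_ideal v).

End Valuations.

(* The third condition is the normalization v(k^* ) = Z. *)
Definition local_field (k : fieldType) (v : k -> int) : Prop :=
  [/\ is_valuation v, val_complete v,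
      forall m : int, exists2 x, x != 0 & v x = m
    & finite_residue_field v].

(* As k is complete, at most one valuation of L satisfies this: the restriction
   to L of the canonical extension of v to an algebraic closure of k. *)
Definition extends_valuation (k : fieldType) (L : fieldExtType k)
    (v : k -> int) (w : L -> rat) : Prop :=
  is_valuation w /\ forall x, x != 0 -> w x%:A = (v x)%:~R.

Section Ideals.
Variable L : fieldType.

Definition ideal_mul (I J : set L) : set L :=
  [set x | exists s : seq (L * L),
     (forall p, p \in s -> I p.1 /\ J p.2) /\ x = \sum_(p <- s) p.1 * p.2].

(* Powers of an ideal I of the domain O; the power 0 is O itself. *)
Definition ideal_exp (O I : set L) (j : nat) : set L :=
  iter j (ideal_mul I) O.

End Ideals.

Section Extension.
Variables (k : fieldType) (L : fieldExtType k) (v : k -> int) (w : L -> rat).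

Let O_ : set L := [set x | x \in int_ring w].
Let m_ : set L := [set x | x \in max_ideal w].

Definition max_ideal_exp (j : nat) : set L := ideal_exp O_ m_ j.

(* The e such that m O_L = m_L^e, where m is the maximal ideal of k. *)
Definition ramification_index : nat :=
  xget 0%N [set e | ideal_mul [set y | exists2 x, x \in max_ideal v & y = x%:A]
                              O_
                    = max_ideal_exp e].

(* The classes of the b i form a basis of O_L / m_L over the residue field of k,
   expressed with representatives. *)
Definition residue_basis (d : nat) (b : 'I_d -> L) : Prop :=
  [/\ forall i, b i \in int_ring w,
      forall x, x \in int_ring w ->
        exists2 a : 'I_d -> k, (forall i, a i \in int_ring v) &
          x - \sum_i a i *: b i \in max_ideal w
    & forall a : 'I_d -> k, (forall i, a i \in int_ring v) ->
        \sum_i a i *: b i \in max_ideal w -> forall i, a i \in max_ideal v].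

Definition residue_degree : nat :=
  xget 0%N [set d | exists b : 'I_d -> L, residue_basis b].

(* The trace of multiplication by x on the k-vector space L. *)
Definition field_trace (x : L) : k :=
  \sum_i coord (vbasis {:L}) i (x * (vbasis {:L})`_i).

Definition codifferent : set L :=
  [set x | forall y, y \in int_ring w -> field_trace (x * y) \in int_ring v].

Definition different : set L :=
  [set y | forall x, codifferent x -> x * y \in int_ring w].

(* max { v(g(theta)) : g in O[x] monic, deg g < deg F } *)
Definition okutsu_mu (F : {poly k}) (theta : L) : rat :=
  let vals := [set c | exists g : {poly k},
    [/\ g \is monic, g \is a polyOver (int_ring v), (size g < size F)%N
      & c = w (map_poly (in_alg L) g).[theta]]] in
  xget 0 [set c | vals c /\ forall c', vals c' -> c' <= c].

End Extension.

(* The discriminant of a monic F of degree n, (-1)^(n(n-1)/2) prod_i F'(t_i)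
   with t_i the roots of F. The library's resultant p q is, for monic q, the
   product of the values of p at the roots of q, hence the argument order. *)
Definition disc (k : fieldType) (F : {poly k}) : k :=
  let n := (size F).-1 in
  (-1) ^+ 'C(n, 2) * resultant F^`() F.

(* Main.v *)
Require Import Defs.
From HB Require Import structures.
From mathcomp Require Import all_boot all_order all_algebra all_field.
From mathcomp Require Import boolp classical_sets.
From mathcomp Require Import lra.
Set Implicit Arguments.
Unset Strict Implicit.
Unset Printing Implicit Defensive.
Import Order.TTheory GRing.Theory Num.Theory.
Local Open Scope ring_scope.

(* Let n = deg F = e f and let tau(x) be the coefficient of theta^(n-1) of x in
   the basis of powers of theta. By Euler, Tr(y) = tau(F'(theta) y), so that the
   pairing tau(x y) makes O[theta] self-dual, and tau(x O_L) is contained in O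
   exactly when x / F'(theta) lies in the codifferent m_L^(-d), d = e - 1 + rho.
   Values g(theta) with g monic of degree n - 1 have tau = 1. If
   tau(x) = 1, then x / (p F'(theta)) is not in the codifferent, hence
   v(x) <= v(F'(theta)) - rho / e. Conversely m_L^(-d-1) is not in the
   codifferent, which yields an x of that valuation with tau(x) = 1 and
   tau(x O_L) in O; by self-duality x is in O[theta], i.e. x = g(theta).
   Thus mu(F) = v(F'(theta)) - rho / e, and
   v(Disc F) = v(N(F'(theta))) = n v(F'(theta)).
   Completeness of k enters through e f = n and v(N(x)) = n v(x), both read off
   the basis pi^j b_i of O_L over O. *)

(** * Matrices of multiplication in a basis; invariance of norm and trace *)

Section MulMatrix.
Variables (k : fieldType) (L : fieldExtType k).

(** For every basis [X], its determinant is the norm of [x] and its trace is [field_trace x]. *)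
Definition mulmat n (X : n.-tuple L) (x : L) : 'M[k]_n :=
  \matrix_(i, j) coord X j (x * X`_i).

Definition basis_change m n (X : m.-tuple L) (Y : n.-tuple L) : 'M[k]_(m, n) :=
  \matrix_(i, j) coord Y j X`_i.

(** Linearity of [phi] along the expansion of [z]. Entries of the matrix products below are sums of
    this shape, with [phi] a coordinate form. *)
Lemma coord_expandM n (X : n.-tuple L) (phi : {scalar L}) y z :
  basis_of fullv X -> \sum_i coord X i z * phi (y * X`_i) = phi (y * z).
Proof.
move=> bX; rewrite [in RHS](coord_basis bX (memvf z)) mulr_sumr linear_sum.
by apply: eq_bigr => i _; rewrite -scalerAr linearZ.
Qed.

Lemma coord_expand n (X : n.-tuple L) (phi : {scalar L}) z :
  basis_of fullv X -> \sum_i coord X i z * phi X`_i = phi z.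
Proof.
move=> bX; rewrite -[in RHS](mul1r z) -(coord_expandM phi 1 z bX).
by apply: eq_bigr => i _; rewrite mul1r.
Qed.

Lemma mulmatM n (X : n.-tuple L) x y : basis_of fullv X ->
  mulmat X (x * y) = mulmat X x *m mulmat X y.
Proof.
move=> bX; apply/matrixP=> i j; rewrite !mxE.
rewrite (eq_bigr (fun l => coord X l (x * X`_i) * coord X j (y * X`_l))).
  by rewrite coord_expandM //= mulrA (mulrC x).
by move=> l _; rewrite !mxE.
Qed.

Lemma mulmat_alg n (X : n.-tuple L) a : basis_of fullv X ->
  mulmat X a%:A = a%:M.
Proof.
move=> bX; apply/matrixP=> i j; rewrite !mxE mulr_algl linearZ /=.
by rewrite (coord_free _ _ (basis_free bX)) mulr_natr.
Qed.

Lemma basis_changeP m n (X : m.-tuple L) (Y : n.-tuple L) x :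
    basis_of fullv X -> basis_of fullv Y ->
  mulmat X x *m basis_change X Y = basis_change X Y *m mulmat Y x.
Proof.
move=> bX bY; apply/matrixP=> i j; rewrite !mxE.
rewrite (eq_bigr (fun l => coord X l (x * X`_i) * coord Y j X`_l)); last first.
  by move=> l _; rewrite !mxE.
rewrite (coord_expand (coord Y j)) //.
rewrite [RHS](eq_bigr (fun l => coord Y l X`_i * coord Y j (x * Y`_l))).
  by rewrite coord_expandM.
by move=> l _; rewrite !mxE.
Qed.

Lemma basis_changeK m n (X : m.-tuple L) (Y : n.-tuple L) :
    basis_of fullv X -> basis_of fullv Y ->
  basis_change X Y *m basis_change Y X = 1%:M.
Proof.
move=> bX bY; apply/matrixP=> i j; rewrite !mxE.
rewrite (eq_bigr (fun l => coord Y l X`_i * coord X j Y`_l)); last first.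
  by move=> l _; rewrite !mxE.
by rewrite (coord_expand (coord X j)) //= (coord_free _ _ (basis_free bX)).
Qed.

Lemma det_mulmat_basis m n (X : m.-tuple L) (Y : n.-tuple L) x :
    basis_of fullv X -> basis_of fullv Y ->
  \det (mulmat X x) = \det (mulmat Y x).
Proof.
move=> bX bY.
(* The lengths agree by dimension, but they must agree in the types before the change of basis
   matrices have determinants. *)
have eq_mn : m = n by rewrite -(size_basis bX) (size_basis bY).
move: eq_mn X Y bX bY => <- X Y bX bY.
have := congr1 determinant (basis_changeP x bX bY).
rewrite !det_mulmx [RHS]mulrC; apply: mulIf.
have /(congr1 determinant) := basis_changeK bX bY.
rewrite det_mulmx det1 => h; apply: contra_eq_neq h => ->.
by rewrite mul0r eq_sym oner_neq0.
Qed.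

(** Cyclicity of the trace holds for products of rectangular matrices, so the two lengths are never
    identified here. *)
Lemma field_trace_basis n (X : n.-tuple L) x : basis_of fullv X ->
  field_trace x = \sum_i coord X i (x * X`_i).
Proof.
move=> bX; have bY := vbasisP {:L}.
have trE m (Z : m.-tuple L) : \sum_i coord Z i (x * Z`_i) = \tr (mulmat Z x).
  by apply: eq_bigr => i _; rewrite mxE.
rewrite /field_trace !trE -[mulmat X x]mulmx1 -(basis_changeK bX bY) mulmxA.
by rewrite basis_changeP // -mulmxA mxtrace_mulC -mulmxA basis_changeK // mulmx1.
Qed.

End MulMatrix.

(** * Resultants as determinants of multiplication modulo a polynomial *)

Section ResultantMod.
Variables (k : fieldType).

(* Reducing the rows 'X^i * p of the Sylvester matrix modulo q is a unimodular
   row operation that leaves a block triangular matrix. *)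
Lemma resultant_modp (p q : {poly k}) : q \is monic ->
  resultant p q =
  \det (\matrix_(i < (size q).-1, j < (size q).-1) (('X^i * p) %% q)`_j).
Proof.
move=> q_monic; set m := (size q).-1; set d := (size p).-1.
have sq : size q = m.+1 by rewrite prednK // size_poly_gt0 monic_neq0.
pose H : 'M[k]_(m, d) := \matrix_(i, j) (('X^i * p) %/ q)`_j.
pose T : 'M[k]_(m + d) := block_mx 1%:M (- H) 0 1%:M.
set R := \matrix_(i, j) _.
(* [Q] and [U] cut the rows ['X^i * q] at column [m]. As [q] is monic of degree [m], [U] is
   triangular with unit diagonal. The boolean multiples annul the entries where the subtraction
   truncates. *)
pose Q := \matrix_(i < d, j < m) (q`_(j - i) *+ (i <= j)%N).
pose U := \matrix_(i < d, j < d) (q`_(m + j - i) *+ (i <= m + j)%N).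
pose band l r : 'M[k]_(l, m + d) := lin1_mx (poly_rV \o r \o* rVpoly).
have TS : T *m Sylvester_mx p q = block_mx R 0 Q U.
  have row_dn : row_mx Q U = band d q.
    apply/matrixP=> i j; rewrite -(splitK j); case: (split j) => {}j /=.
      rewrite row_mxEl !mxE /= rVpoly_delta coefXnM ltnNge.
      by case: (i <= j)%N => //=; rewrite mulr0n.
    rewrite row_mxEr !mxE /= rVpoly_delta coefXnM ltnNge.
    by case: (i <= m + j)%N => //=; rewrite mulr0n.
  have row_up : row_mx R 0 =
      band m p - H *m band d q.
    apply/matrixP=> i j.
    pose h := ('X^i * p) %/ q.
    (* As [i < m], the quotient has at most [d] coefficients, so the [d] rows ['X^l * q] suffice to
       reduce ['X^i * p]. *)
    have sh : (size h <= d)%N.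
      rewrite /h size_divp ?monic_neq0 // sq.
      have [->|p0] := eqVneq p 0; first by rewrite mulr0 size_poly0.
      rewrite size_monicM ?monicXn // size_polyXn addSn /= leq_subLR.
      have dS : size p = d.+1 by rewrite prednK ?size_poly_gt0.
      by rewrite dS addnS -addSn leq_add2r.
    transitivity (('X^i * p) %% q)`_j.
      rewrite -(splitK j); case: (split j) => {}j /=.
        by rewrite row_mxEl !mxE.
      rewrite row_mxEr !mxE nth_default //.
      by rewrite (leq_trans _ (leq_addr _ _)) // -ltnS -sq ltn_modp monic_neq0.
    have -> : ('X^i * p) %% q = 'X^i * p - h * q.
      by rewrite [in RHS](divp_eq ('X^i * p) q) addrC addKr.
    rewrite coefB !mxE /= rVpoly_delta; congr (_ - _).
    have -> : h = \sum_(l < d) h`_l *: 'X^l.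
      rewrite -poly_def; apply/polyP=> l; rewrite coef_poly.
      by case: ltnP => // dl; rewrite nth_default // (leq_trans sh).
    rewrite mulr_suml coef_sum; apply: eq_bigr => l _.
    by rewrite !mxE /= rVpoly_delta -scalerAl coefZ.
  rewrite [RHS]block_mxEv row_up row_dn /T block_mxEv mul_col_mx !mul_row_col.
  by rewrite !mul1mx mul0mx add0r mulNmx.
have detT : \det T = 1 by rewrite det_ublock !det1 mulr1.
have detU : \det U = 1.
  rewrite det_trig.
    apply: big1 => i _; rewrite mxE addnK leq_addl mulr1n.
    by move/monicP: q_monic; rewrite lead_coefE sq.
  apply/is_trig_mxP => i j ij; rewrite mxE nth_default ?mul0rn //.
  by rewrite sq -(addnBA _ (ltnW ij)) -[m.+1]addn1 leq_add2l subn_gt0.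
have /(congr1 determinant) := TS.
by rewrite det_mulmx detT mul1r det_lblock detU mulr1.
Qed.

End ResultantMod.

(** * The power basis of L, its dual basis and Euler's trace formula *)

Section PowerBasis.
Variables (k : fieldType) (L : fieldExtType k) (F : {poly k}) (m : nat).
Variable theta : L.
Hypotheses (F_monic : F \is monic) (F_irr : irreducible_poly F).
Hypothesis size_F : size F = m.+2.
Hypothesis F_theta : root (map_poly (in_alg L) F) theta.
Hypothesis theta_gen : <<1%AS; theta>>%VS = fullv.

(** The degree n is written [m.+1] so that the last index [ord_max] exists. *)
Definition powers : m.+1.-tuple L := [tuple theta ^+ i | i < m.+1].

Local Notation ev p := (map_poly (in_alg L) p).[theta].

Lemma evM p q : ev (p * q) = ev p * ev q.
Proof. by rewrite rmorphM hornerM. Qed.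

Lemma ev_F : ev F = 0. Proof. exact/rootP. Qed.

Lemma ev_modF p : ev (p %% F) = ev p.
Proof.
by rewrite [in RHS](divp_eq p F) rmorphD hornerD /= evM ev_F mulr0 add0r.
Qed.

Lemma size_modF p : (size (p %% F)%R <= m.+1)%N.
Proof. by rewrite -ltnS -size_F ltn_modp monic_neq0. Qed.

Lemma powersE (i : 'I_m.+1) : powers`_i = theta ^+ i.
Proof. by rewrite -tnth_nth tnth_mktuple. Qed.

Lemma ev_powers (p : {poly k}) : (size p <= m.+1)%N -> ev p = \sum_(i < m.+1) p`_i *: powers`_i.
Proof.
move=> sp; rewrite (@horner_coef_wide _ m.+1) ?size_map_poly //.
by apply: eq_bigr => i _; rewrite coef_map powersE mulr_algl.
Qed.

Lemma ev_surj z : exists2 p : {poly k}, (size p <= m.+1)%N & z = ev p.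
Proof.
have /Fadjoin1_polyP[p ->] : z \in <<1; theta>>%VS by rewrite theta_gen memvf.
by exists (p %% F); rewrite ?size_modF ?ev_modF.
Qed.

(** Reduction modulo [F] shows that the powers span. The dimension is the degree of the minimal
    polynomial of [theta], which divides the irreducible [F] and hence has its degree. *)
Lemma powers_basis : basis_of fullv powers.
Proof.
rewrite basisEdim size_tuple; apply/andP; split.
  apply/subvP=> z _; have [p sp ->] := ev_surj z.
  rewrite ev_powers //; apply: memv_suml => i _.
  by rewrite memvZ ?memv_span ?mem_nth ?size_tuple.
have /polyOver1P [q Dq] := minPolyOver 1 theta.
have q_dvd_F : q %| F.
  have := @minPoly_dvdp _ _ 1%AS theta (map_poly (in_alg L) F).
  rewrite Dq dvdp_map; apply=> //; exact/alg_polyOver.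
have szq : size q = (\dim {:L}).+1.
  rewrite -(size_map_poly (in_alg L)) -Dq size_minPoly.
  by rewrite -theta_gen dim_Fadjoin dimv1 muln1.
have [_ /(_ q)] := F_irr.
rewrite szq eqSS -lt0n adim_gt0 => /(_ isT q_dvd_F)/eqp_size.
by rewrite szq size_F => -[->].
Qed.

Lemma coord_ev (p : {poly k}) (i : 'I_m.+1) : (size p <= m.+1)%N -> coord powers i (ev p) = p`_i.
Proof.
move=> sp; rewrite ev_powers //.
by rewrite (coord_sum_free (fun j => p`_j)) ?(basis_free powers_basis).
Qed.

Definition top_coord (z : L) : k := coord powers ord_max z.

Lemma top_coord_ev (p : {poly k}) : (size p <= m.+1)%N -> top_coord (ev p) = p`_m.
Proof. exact: coord_ev. Qed.

Lemma top_coordZ a z : top_coord (a *: z) = a * top_coord z.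
Proof. by rewrite /top_coord linearZ. Qed.

Lemma size_drop_F j : (size (drop_poly j.+1 F) <= m.+1)%N.
Proof. by rewrite size_drop_poly size_F subSS leq_subr. Qed.

(* The drop_poly j.+1 F are the coefficients of F(x) / (x - theta), which form
   Euler's dual basis of the powers of theta. *)
Lemma top_coord_dual (i j : nat) : (i <= m)%N -> (j <= m)%N ->
  top_coord (theta ^+ i * ev (drop_poly j.+1 F)) = (i == j)%:R.
Proof.
(* Horner's recursion; it lets the induction lower the exponent [i] and the index [j] together. *)
have dropS l : ev (drop_poly l F) = theta * ev (drop_poly l.+1 F) + (F`_l)%:A.
  have -> : drop_poly l F = 'X * drop_poly l.+1 F + (F`_l)%:P.
    apply/polyP=> i'; rewrite coefD coefXM coefC !coef_drop_poly.
    by case: i' => [|i'] /=; rewrite ?add0r // addr0 addSnnS.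
  by rewrite rmorphD /= hornerD evM /= map_polyX hornerX map_polyC hornerC.
elim: i j => [|i IHi] j im jm.
  rewrite expr0 mul1r top_coord_ev ?size_drop_F // coef_drop_poly.
  case: j jm => [|j] _ /=.
    by move/monicP: F_monic; rewrite lead_coefE size_F addn1.
  by rewrite nth_default // size_F addnS ltnS addnS ltnS leq_addr.
have step : theta ^+ i.+1 * ev (drop_poly j.+1 F) =
    theta ^+ i * ev (drop_poly j F) - F`_j *: theta ^+ i.
  rewrite (dropS j) mulrDr mulr_algr addrK exprS mulrA.
  by rewrite [theta * _]mulrC.
have top_pow : top_coord (theta ^+ i) = 0.
  have -> : theta ^+ i = ev 'X^i by rewrite map_polyXn hornerXn.
  by rewrite top_coord_ev ?size_polyXn ?coefXn ?gtn_eqF // ltnW.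
rewrite step /top_coord linearB /= -!/(top_coord _) top_coordZ top_pow mulr0 subr0.
(* At index [0] the recursion reaches [F] itself, which vanishes at [theta]. *)
case: j jm {step} => [|j] jm; last by rewrite IHi ?eqSS // ltnW.
by rewrite drop_poly0l ev_F mulr0 /top_coord linear0.
Qed.

(** This gives the self-duality of O[theta]: for integral [F] the dual basis lies in O[theta], so
    tau(z O_L) contained in O forces [z] to lie in O[theta]. *)
Lemma coord_dual (j : 'I_m.+1) z :
  coord powers j z = top_coord (z * ev (drop_poly j.+1 F)).
Proof.
have dual (i : 'I_m.+1) :
    coord powers ord_max (ev (drop_poly j.+1 F) * powers`_i) = (i == j)%:R.
  by rewrite powersE mulrC; apply: top_coord_dual; rewrite -ltnS ltn_ord.
rewrite mulrC /top_coord -(coord_expandM (coord powers ord_max) _ _ powers_basis).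
rewrite (bigD1 j) //= dual eqxx mulr1 big1 ?addr0 // => i ij.
by rewrite dual (negPf ij) mulr0.
Qed.

Lemma sum_drop_deriv : \sum_(j < m.+1) 'X^j * drop_poly j.+1 F = F^`().
Proof.
apply/polyP=> l; rewrite coef_deriv coef_sum.
have [lm|ml] := leqP l m; last first.
  rewrite (nth_default 0) ?size_F // mul0rn big1 // => j _.
  rewrite coefXnM; case: ifP => // _; rewrite coef_drop_poly nth_default // size_F.
  by have := ltn_ord j; rewrite ltnS => jm; rewrite addnS ltnS subnK // ltnW // (leq_ltn_trans jm).
rewrite -(big_mkord xpredT (fun j => ('X^j * drop_poly j.+1 F)`_l)).
rewrite (big_cat_nat (n := l.+1)) //= [X in _ + X]big_nat [X in _ + X]big1 ?addr0; last first.
  by move=> j /andP[lj _]; rewrite coefXnM lj.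
rewrite big_nat (eq_bigr (fun=> F`_l.+1)) -?big_nat ?sumr_const_nat ?subn0 //.
move=> j /andP[_]; rewrite ltnS => jl.
by rewrite coefXnM ltnNge jl /= coef_drop_poly addnS subnK.
Qed.

Lemma trace_top_coord y : field_trace y = top_coord (y * ev F^`()).
Proof.
rewrite (field_trace_basis _ powers_basis) -sum_drop_deriv rmorph_sum horner_sum.
rewrite mulr_sumr /top_coord linear_sum; apply: eq_bigr => j _.
rewrite coord_dual powersE evM /= map_polyXn hornerXn.
by rewrite -mulrA.
Qed.

(** The remainders of the ['X^i * p] modulo [F] list the coordinates of [theta ^+ i * ev p], so the
    resultant is the norm of [ev p]. *)
Lemma resultant_mulmat p : resultant p F = \det (mulmat powers (ev p)).
Proof.
rewrite resultant_modp // size_F; congr (\det _); apply/matrixP=> i j; rewrite !mxE.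
rewrite -coord_ev ?size_modF // ev_modF evM /= map_polyXn hornerXn powersE.
by rewrite mulrC.
Qed.

End PowerBasis.

(** * Elementary consequences of the valuation axioms *)

Section ValuationTheory.
Variables (K : fieldType) (G : realDomainType) (v : K -> G).
Hypothesis v_val : is_valuation v.

Lemma vvalM x y : x != 0 -> y != 0 -> v (x * y) = v x + v y.
Proof. by case: v_val => + _; apply. Qed.

Lemma vval1 : v 1 = 0.
Proof.
have := vvalM (oner_neq0 K) (oner_neq0 K); rewrite mulr1.
by move/(congr1 (fun z => z - v 1)); rewrite subrr addrK.
Qed.

Lemma vvalV x : x != 0 -> v x^-1 = - v x.
Proof.
move=> x0; apply/eqP; rewrite -subr_eq0 opprK -vvalM ?invr_eq0 //.
by rewrite mulVf // vval1.
Qed.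

(** Twice [v (-1)] is [v 1 = 0], and an ordered group has no torsion. *)
Lemma vvalN x : v (- x) = v x.
Proof.
have [->|x0] := eqVneq x 0; first by rewrite oppr0.
have N1 : (-1 : K) != 0 by rewrite oppr_eq0 oner_neq0.
have /eqP : v (-1) + v (-1) = 0 by rewrite -vvalM // mulrNN mulr1 vval1.
rewrite -mulr2n mulrn_eq0 /= => /eqP h.
by rewrite -mulN1r vvalM // h add0r.
Qed.

Lemma vvalX x n : x != 0 -> v (x ^+ n) = v x *+ n.
Proof.
move=> x0; elim: n => [|n IHn]; first by rewrite expr0 vval1 mulr0n.
by rewrite exprS vvalM ?expf_neq0 // IHn mulrS.
Qed.

Lemma vvalXz x (z : int) : x != 0 -> v (x ^ z) = v x *~ z.
Proof.
move=> x0; case: z => n; first exact: vvalX.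
by rewrite NegzE -exprnN vvalV ?expf_neq0 // vvalX // mulrNz.
Qed.

Lemma val_geE c x : x != 0 -> (x \in val_ge v c) = (c <= v x).
Proof. by move=> x0; rewrite inE (negPf x0). Qed.

Lemma val_gtE c x : x != 0 -> (x \in val_gt v c) = (c < v x).
Proof. by move=> x0; rewrite inE (negPf x0). Qed.

Lemma val_ge0 c : 0 \in val_ge v c. Proof. by rewrite inE eqxx. Qed.

Lemma val_gt0 c : 0 \in val_gt v c. Proof. by rewrite inE eqxx. Qed.

Lemma int_ring1 : 1 \in int_ring v.
Proof. by rewrite val_geE ?oner_neq0 // vval1. Qed.

Lemma val_geN c x : (- x \in val_ge v c) = (x \in val_ge v c).
Proof. by rewrite !inE oppr_eq0 vvalN. Qed.

Lemma val_gtN c x : (- x \in val_gt v c) = (x \in val_gt v c).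
Proof. by rewrite !inE oppr_eq0 vvalN. Qed.

Lemma val_leD x y : x != 0 -> y != 0 -> x + y != 0 ->
  Num.min (v x) (v y) <= v (x + y).
Proof. by case: v_val => _; apply. Qed.

Lemma val_geD c x y : x \in val_ge v c -> y \in val_ge v c ->
  x + y \in val_ge v c.
Proof.
have [->|x0] := eqVneq x 0; first by rewrite add0r.
have [->|y0] := eqVneq y 0; first by rewrite addr0.
have [->|xy0] := eqVneq (x + y) 0; first by rewrite val_ge0.
rewrite !val_geE // => cx cy.
by apply: le_trans (val_leD x0 y0 xy0); rewrite le_min cx.
Qed.

Lemma val_gtD c x y : x \in val_gt v c -> y \in val_gt v c ->
  x + y \in val_gt v c.
Proof.
have [->|x0] := eqVneq x 0; first by rewrite add0r.
have [->|y0] := eqVneq y 0; first by rewrite addr0.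
have [->|xy0] := eqVneq (x + y) 0; first by rewrite val_gt0.
rewrite !val_gtE // => cx cy.
by apply: lt_le_trans (val_leD x0 y0 xy0); rewrite lt_min cx.
Qed.

Lemma val_geB c x y : x \in val_ge v c -> y \in val_ge v c ->
  x - y \in val_ge v c.
Proof. by move=> cx cy; rewrite val_geD ?val_geN. Qed.

Lemma val_gtB c x y : x \in val_gt v c -> y \in val_gt v c ->
  x - y \in val_gt v c.
Proof. by move=> cx cy; rewrite val_gtD ?val_gtN. Qed.

Lemma val_geM c d x y : x \in val_ge v c -> y \in val_ge v d ->
  x * y \in val_ge v (c + d).
Proof.
have [->|x0] := eqVneq x 0; first by move=> *; rewrite mul0r val_ge0.
have [->|y0] := eqVneq y 0; first by move=> *; rewrite mulr0 val_ge0.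
by rewrite !val_geE ?mulf_neq0 // vvalM // => cx dy; exact: lerD.
Qed.

Lemma val_gtM c d x y : x \in val_ge v c -> y \in val_gt v d ->
  x * y \in val_gt v (c + d).
Proof.
have [->|x0] := eqVneq x 0; first by move=> *; rewrite mul0r val_gt0.
have [->|y0] := eqVneq y 0; first by move=> *; rewrite mulr0 val_gt0.
by rewrite val_geE // !val_gtE ?mulf_neq0 // vvalM // => cx dy; exact: ler_ltD.
Qed.

Lemma int_ringM x y : x \in int_ring v -> y \in int_ring v ->
  x * y \in int_ring v.
Proof. by rewrite /int_ring -[X in x * y \in val_ge v X]addr0; exact: val_geM. Qed.

Lemma int_ringX x n : x \in int_ring v -> x ^+ n \in int_ring v.
Proof.
move=> Ox; elim: n => [|n IHn]; first by rewrite int_ring1.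
by rewrite exprS int_ringM.
Qed.

Lemma val_ge_sum (I : Type) (r : seq I) (P : pred I) (f : I -> K) c :
  (forall i, P i -> f i \in val_ge v c) -> \sum_(i <- r | P i) f i \in val_ge v c.
Proof.
move=> fc; apply: (big_ind (fun x => x \in val_ge v c)) => //.
  exact: val_ge0.
by move=> x y; exact: val_geD.
Qed.

Lemma val_gt_sum (I : Type) (r : seq I) (P : pred I) (f : I -> K) c :
  (forall i, P i -> f i \in val_gt v c) -> \sum_(i <- r | P i) f i \in val_gt v c.
Proof.
move=> fc; apply: (big_ind (fun x => x \in val_gt v c)) => //.
  exact: val_gt0.
by move=> x y; exact: val_gtD.
Qed.

Lemma int_ring_prod (I : Type) (r : seq I) (P : pred I) (f : I -> K) :
  (forall i, P i -> f i \in int_ring v) -> \prod_(i <- r | P i) f i \in int_ring v.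
Proof.
move=> fc; apply: (big_ind (fun x => x \in int_ring v)) => //.
  exact: int_ring1.
by move=> x y; exact: int_ringM.
Qed.

Lemma int_ring_det n (A : 'M[K]_n) :
  (forall i j, A i j \in int_ring v) -> \det A \in int_ring v.
Proof.
move=> OA; apply: val_ge_sum => s _.
rewrite int_ringM ?int_ring_prod ?int_ringX //.
by rewrite /int_ring val_geN int_ring1.
Qed.

Lemma val_ge_trans c d x : c <= d -> x \in val_ge v d -> x \in val_ge v c.
Proof.
move=> cd; have [->|x0] := eqVneq x 0; first by rewrite !val_ge0.
by rewrite !val_geE //; exact: le_trans.
Qed.

Lemma val_ge_gt c d x : c < d -> x \in val_ge v d -> x \in val_gt v c.
Proof.
move=> cd; have [->|x0] := eqVneq x 0; first by rewrite val_gt0.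
by rewrite val_geE // val_gtE //; exact: lt_le_trans.
Qed.

Lemma val_geMl c x y : x != 0 -> (x * y \in val_ge v (v x + c)) = (y \in val_ge v c).
Proof.
move=> x0; have [->|y0] := eqVneq y 0; first by rewrite mulr0 !val_ge0.
by rewrite !val_geE ?mulf_neq0 // vvalM // lerD2l.
Qed.

(* The ultrametric inequality is strict only if the minimum is attained twice. *)
Lemma val_sum0_eq (I : finType) (f : I -> K) i0 : f i0 != 0 -> \sum_i f i = 0 ->
  exists i j, [/\ i != j, f i != 0, f j != 0 & v (f i) = v (f j)].
Proof.
move=> fi0 sf0; case: (@arg_minP _ G I i0 (fun i => f i != 0) (v \o f) fi0) => i fi min_i.
have [/existsP[j /and3P[ij fj /eqP vij]]|] :=
    boolP [exists j, [&& i != j, f j != 0 & v (f i) == v (f j)]].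
  by exists i, j.
rewrite negb_exists => /forallP all_gt.
have: f i \in val_gt v (v (f i)).
  rewrite [X in X \in _](_ : f i = - \sum_(j | j != i) f j); last first.
    by apply/eqP; move/eqP: sf0; rewrite (bigD1 i) //= addr_eq0.
  rewrite val_gtN; apply: val_gt_sum => j ji.
  have [->|fj] := eqVneq (f j) 0; first by rewrite val_gt0.
  rewrite val_gtE // lt_neqAle; apply/andP; split; last exact: min_i.
  by have := all_gt j; rewrite eq_sym ji fj.
by rewrite val_gtE // ltxx.
Qed.

End ValuationTheory.

(** * Discreteness of the extended valuation *)

Section Extension.
Variables (k : fieldType) (L : fieldExtType k) (v : k -> int) (w : L -> rat).
Hypothesis v_local : local_field v.
Hypothesis w_ext : extends_valuation v w.

Let v_val : is_valuation v. Proof. by case: v_local. Qed.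
Let w_val : is_valuation w. Proof. by case: w_ext. Qed.

Lemma alg_neq0 (a : k) : (a%:A != 0 :> L) = (a != 0).
Proof. by rewrite scaler_eq0 oner_eq0 orbF. Qed.

Lemma vval_alg a : a != 0 -> w a%:A = (v a)%:~R.
Proof. by case: w_ext => _; apply. Qed.

Lemma vvalZ a x : a != 0 -> x != 0 -> w (a *: x) = (v a)%:~R + w x.
Proof. by move=> a0 x0; rewrite -mulr_algl vvalM ?alg_neq0 // vval_alg. Qed.

Lemma val_ge_alg a (c : int) : (a%:A \in val_ge w c%:~R) = (a \in val_ge v c).
Proof.
have [->|a0] := eqVneq a 0; first by rewrite scale0r !val_ge0.
by rewrite !val_geE ?alg_neq0 // vval_alg // ler_int.
Qed.

Lemma int_ring_alg a : (a%:A \in int_ring w) = (a \in int_ring v).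
Proof. exact: (val_ge_alg a 0). Qed.

Lemma max_ideal_int a : (a \in max_ideal v) = (a \in val_ge v 1).
Proof. by rewrite !inE. Qed.

Lemma max_ideal_alg a : (a%:A \in max_ideal w) = (a \in max_ideal v).
Proof.
have [->|a0] := eqVneq a 0; first by rewrite scale0r !val_gt0.
by rewrite !val_gtE ?alg_neq0 // vval_alg // ltr0z.
Qed.

Lemma int_ringZ a y : a \in int_ring v -> y \in int_ring w -> a *: y \in int_ring w.
Proof. by move=> Oa Oy; rewrite -mulr_algl int_ringM ?int_ring_alg. Qed.

Lemma int_ring_comb (I : finType) (a : I -> k) (B : I -> L) :
    (forall i, a i \in int_ring v) -> (forall i, B i \in int_ring w) ->
  \sum_i a i *: B i \in int_ring w.
Proof. by move=> Oa OB; apply: val_ge_sum => // i _; apply: int_ringZ. Qed.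

Lemma exists_unif : exists2 p : k, p != 0 & v p = 1.
Proof. by case: v_local => _ _ /(_ 1) [p p0 vp] _; exists p. Qed.

(* Two terms of the minimal equation of x have the same valuation. *)
Lemma val_denom x : x != 0 ->
  exists z : int, (\dim {:L})`!%:R * w x = z%:~R.
Proof.
move=> x0; have /polyOver1P [q Dq] := minPolyOver 1 x.
have q_monic : q \is monic.
  by rewrite -(map_monic (in_alg L)) -Dq monic_minPoly.
have size_q : (size q <= (\dim {:L}).+1)%N.
  rewrite -(size_map_poly (in_alg L)) -Dq size_minPoly ltnS.
  by have := dim_Fadjoin 1 x; rewrite dimv1 muln1 => <-; rewrite dimvS ?subvf.
have q_gt0 : (0 < size q)%N by rewrite size_poly_gt0 monic_neq0.
have lt_last : ((size q).-1 < size q)%N by rewrite prednK.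
have [] := @val_sum0_eq _ _ w w_val _ (fun i : 'I_(size q) => q`_i *: x ^+ i)
  (Ordinal lt_last).
- by rewrite /= -lead_coefE (monicP q_monic) scale1r expf_neq0.
- rewrite -[RHS](minPolyxx 1 x) Dq (@horner_coef_wide _ (size q)) ?size_map_poly //.
  by apply: eq_bigr => i _; rewrite coef_map mulr_algl.
move=> i [j [ij]]; rewrite !scaler_eq0 !negb_or => /andP[qi0 xi0] /andP[qj0 xj0].
rewrite !vvalZ // !vvalX //.
wlog lt_ij : i j ij qi0 xi0 qj0 xj0 / (i < j)%N.
  move=> wlogH; case: (ltngtP i j) => [|ji|/val_inj eq_ij]; first exact: wlogH.
    by move/esym; apply: wlogH; rewrite // eq_sym.
  by rewrite eq_ij eqxx in ij.
move=> eq_v.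
(* Now [(j - i) * w x = v q]_i - v q[_j]. Since [j - i] is at most the dimension, it divides the
   factorial: one denominator serves every [x]. *)
have le_d : (j - i <= \dim {:L})%N.
  by rewrite (leq_trans (leq_subr _ _)) // -ltnS (leq_trans _ size_q).
have /dvdnP[c Dc] : (j - i %| (\dim {:L})`!)%N by rewrite dvdn_fact // subn_gt0 lt_ij.
exists (c%:Z * (v q`_i - v q`_j)).
rewrite Dc natrM -mulrA rmorphM /= rmorphB /= natrB 1?ltnW //.
congr (_ * _); rewrite mulrBl !mulr_natl; apply/eqP.
by rewrite subr_eq addrAC -subr_eq opprK eq_v addrC.
Qed.

(** By the common denominator there is a least positive value. Euclidean division makes every value
    a multiple of it, and the value 1 of a uniformizer of [k] makes it the inverse of an integer. *)
Lemma exists_unif_ext : exists E : nat, exists pi : L,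
  [/\ (0 < E)%N, pi != 0, w pi = E%:R^-1
    & forall x, x != 0 -> exists z : int, w x = z%:~R / E%:R].
Proof.
have [p p0 vp] := exists_unif.
pose N := (\dim {:L})`!; have N_gt0 : (0 < N)%N := fact_gt0 _.
have N0 : N%:R != 0 :> rat by rewrite pnatr_eq0 -lt0n.
pose P m := `[< exists2 x : L, x != 0 & N%:R * w x = m.+1%:R >].
have exP : exists m, P m.
  exists N.-1; apply/asboolP; exists p%:A; rewrite ?alg_neq0 //.
  by rewrite vval_alg // vp mulr1 prednK.
case: (ex_minnP exP) => m /asboolP[pi pi0 wpi] min_m.
have mult x : x != 0 -> exists z : int, w x = z%:~R * w pi.
  move=> x0; have [z wx] := val_denom x0.
  pose q := (z %/ m.+1%:Z)%Z; pose r := (z %% m.+1%:Z)%Z.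
  exists q; apply: (mulfI N0); rewrite mulrCA wpi wx (divz_eq z m.+1%:Z) -/q -/r.
  (* A nonzero remainder would be the numerator of a smaller positive value, attained at
     [x * pi ^ (- q)]. *)
  suff -> : r = 0 by rewrite addr0 rmorphM.
  have r_ge0 : 0 <= r by exact: modz_ge0.
  have r_lt : r < m.+1%:Z by exact: ltz_pmod.
  case Dr: r r_ge0 r_lt => [[|s]|] // _ s_lt.
  have : P s.
    apply/asboolP; exists (x * pi ^ (- q)); rewrite ?mulf_neq0 ?expfz_neq0 //.
    rewrite vvalM ?expfz_neq0 // vvalXz // mulrDr wx -[w pi *~ _]mulrzr mulrA wpi.
    rewrite (divz_eq z m.+1%:Z) -/q -/r Dr rmorphD rmorphN rmorphM /=.
    by rewrite mulrN [_ * q%:~R]mulrC addrAC subrr add0r.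
  by move/min_m; rewrite leqNgt; move: s_lt; rewrite ltz_nat ltnS => ->.
have wpi_gt0 : 0 < w pi.
  by rewrite -(pmulr_rgt0 _ (_ : 0 < N%:R)) ?ltr0n // wpi ltr0n.
have [q] : exists q : int, w p%:A = q%:~R * w pi by apply: mult; rewrite alg_neq0.
rewrite vval_alg // vp => q1.
have q_gt0 : 0 < q.
  have : 0 < q%:~R * w pi by rewrite -q1 ltr01.
  by rewrite pmulr_lgt0 // ltr0z.
case: q q_gt0 q1 => // E E_gt0 E1; exists E, pi.
have Dpi : w pi = E%:R^-1.
  apply: (mulfI (_ : E%:R != 0)); rewrite ?pnatr_eq0 -?lt0n //.
  by rewrite mulfV ?pnatr_eq0 -?lt0n // E1.
by split=> // x x0; have [z ->] := mult x x0; exists z; rewrite Dpi.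
Qed.

(** * Powers of the maximal ideal and the ramification index *)

Variables (E : nat) (pi : L).
Hypotheses (E_gt0 : (0 < E)%N) (pi_neq0 : pi != 0) (val_pi : w pi = E%:R^-1).
Hypothesis val_discrete : forall x, x != 0 -> exists z : int, w x = z%:~R / E%:R.

Let E_neq0 : E%:R != 0 :> rat. Proof. by rewrite pnatr_eq0 -lt0n. Qed.
Let E_gt0r : 0 < E%:R :> rat. Proof. by rewrite ltr0n. Qed.

Lemma val_piX j : w (pi ^+ j) = j%:R / E%:R.
Proof. by rewrite vvalX // val_pi mulr_natl. Qed.

Lemma val_piXz (z : int) : w (pi ^ z) = z%:~R / E%:R.
Proof. by rewrite vvalXz // val_pi -mulrzl. Qed.

Lemma val_gt_discrete (c : int) x :
  (x \in val_gt w (c%:~R / E%:R)) = (x \in val_ge w ((c + 1)%:~R / E%:R)).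
Proof.
have [->|x0] := eqVneq x 0; first by rewrite val_gt0 val_ge0.
rewrite val_gtE // val_geE //; have [z ->] := val_discrete x0.
by rewrite ltr_pM2r ?invr_gt0 // ler_pM2r ?invr_gt0 // ltr_int ler_int lezD1.
Qed.

Lemma max_idealE x : (x \in max_ideal w) = (x \in val_ge w (1 / E%:R)).
Proof. by have := val_gt_discrete 0 x; rewrite mul0r add0r. Qed.

(** From right to left the single product [pi * (pi^-1 * x)] suffices, as [pi] generates the maximal
    ideal. *)
Lemma max_ideal_expE j x : max_ideal_exp w j x <-> x \in val_ge w (j%:R / E%:R).
Proof.
elim: j x => [|j IHj] x; first by rewrite mul0r.
rewrite /max_ideal_exp /ideal_exp iterS; split.
  move=> [s [sP ->]]; rewrite big_seq; apply: val_ge_sum => // -[y z] /sP /= [my Iz].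
  rewrite -natr1 addrC mulrDl; apply: val_geM => //; first by rewrite -max_idealE.
  exact/IHj.
move=> Ix; exists [:: (pi, pi^-1 * x)]; split; last first.
  by rewrite big_seq1 /= mulVKf.
move=> _ /[!inE]/eqP->; split => /=.
  by rewrite max_idealE val_geE // val_pi mul1r.
apply/IHj; rewrite -(val_geMl w_val _ _ pi_neq0) mulVKf // val_pi.
by rewrite -[X in X + _]mul1r -mulrDl nat1r.
Qed.

(** [xget] is determined only if the exponent is unique; [pi ^+ E] and [pi ^+ e] compare two
    candidates. *)
Lemma ramification_indexE : ramification_index v w = E.
Proof.
have [p p0 vp] := exists_unif.
have w1 : w p%:A = 1 by rewrite vval_alg // vp.
have P0 : p%:A != 0 :> L by rewrite alg_neq0.
set mO := ideal_mul (fun y : L => exists2 x, x \in max_ideal v & y = x%:A)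
  (fun x => x \in int_ring w).
have mOE x : mO x <-> x \in val_ge w 1.
  split.
    move=> [s [sP ->]]; rewrite big_seq; apply: val_ge_sum => // -[y z] /sP /=.
    move=> [[a ma ->] Oz]; rewrite -[X in val_ge w X]addr0; apply: val_geM => //.
    by rewrite (val_ge_alg a 1) -max_ideal_int.
  move=> x1; exists [:: (p%:A, p%:A^-1 * x)]; split; last first.
    by rewrite big_seq1 /= mulVKf.
  have Oq : p%:A^-1 * x \in int_ring w.
    by rewrite /int_ring -(val_geMl w_val _ _ P0) mulVKf // w1 addr0.
  move=> _ /[!inE]/eqP->; split; last exact: Oq.
  by exists p; rewrite // max_ideal_int val_geE // vp.
apply: xget_unique.
  apply/seteqP; split=> x.
    by move=> /mOE Ix; apply/max_ideal_expE; rewrite divff.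
  by move=> /max_ideal_expE; rewrite divff // => ?; apply/mOE.
move=> e eq_e; have {}eq_e x : mO x <-> max_ideal_exp w e x.
  by rewrite -[max_ideal_exp w e]eq_e.
apply/eqP; rewrite eqn_leq; apply/andP; split.
  have /max_ideal_expE : max_ideal_exp w e (pi ^+ E).
    by apply/eq_e/mOE; rewrite val_geE ?expf_neq0 // val_piX divff.
  by rewrite val_geE ?expf_neq0 // val_piX ler_pM2r ?invr_gt0 // ler_nat.
have /mOE : mO (pi ^+ e).
  by apply/eq_e/max_ideal_expE; rewrite val_geE ?expf_neq0 // val_piX.
by rewrite val_geE ?expf_neq0 // val_piX ler_pdivlMr // mul1r ler_nat.
Qed.

(** * Integral bases of O_L over O from bases modulo p *)

Definition pure_family (I : finType) (B : I -> L) :=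
  forall a : I -> k, (forall i, a i \in int_ring v) ->
    \sum_i a i *: B i \in val_ge w 1 -> forall i, a i \in max_ideal v.

(** For a uniformizer p of [k], [val_ge w 1] is p O_L. For integral families this is generation of
    O_L / p O_L over the residue field of [k], and [pure_family] is independence there. *)
Definition spans_modp (I : finType) (B : I -> L) :=
  forall x, x \in int_ring w -> exists2 a : I -> k,
    (forall i, a i \in int_ring v) & x - \sum_i a i *: B i \in val_ge w 1.

(** Otherwise, dividing by a coefficient of least, negative valuation gives integral coefficients,
    one of them 1, with sum in p O_L. *)
Lemma pure_int (I : finType) (B : I -> L) (a : I -> k) : pure_family B ->
  \sum_i a i *: B i \in int_ring w -> forall i, a i \in int_ring v.
Proof.
move=> pureB sO; have [p p0 vp] := exists_unif.
have [/forallP //|] := boolP [forall i, a i \in int_ring v].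
rewrite negb_forall => /existsP[i0 ai0].
have ai0_neq0 : a i0 != 0 by apply: contraNneq ai0 => ->; rewrite val_ge0.
case: (@arg_minP _ _ I i0 (fun i => a i != 0) (v \o a) ai0_neq0) => i ai min_i.
have vai : v (a i) < 0.
  apply: le_lt_trans (min_i i0 ai0_neq0) _ => /=.
  by rewrite ltNge; move: ai0; rewrite val_geE.
pose c := a i.
have Oa j : a j / c \in int_ring v.
  have [->|aj] := eqVneq (a j) 0; first by rewrite mul0r val_ge0.
  rewrite /int_ring val_geE ?mulf_neq0 ?invr_eq0 // vvalM ?invr_eq0 // vvalV //.
  by rewrite subr_ge0; exact: min_i.
have := pureB _ Oa; rewrite (eq_bigr (fun j => c^-1 *: (a j *: B j))); last first.
  by move=> j _; rewrite scalerA mulrC.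
rewrite -scaler_sumr => /(_ _ i); rewrite divff // max_ideal_int.
rewrite (val_geE _ _ (oner_neq0 _)) vval1 // => contra.
suff: c^-1 *: (\sum_j a j *: B j) \in val_ge w 1 by move/contra.
rewrite -mulr_algl -[X in val_ge w X]addr0; apply: val_geM => //.
rewrite (val_ge_alg c^-1 1) val_geE ?invr_eq0 // vvalV //.
by rewrite lerNr; rewrite -ltzD1 addrC subrr.
Qed.

Lemma pure_inj (I : finType) (B : I -> L) (a : I -> k) : pure_family B ->
  \sum_i a i *: B i = 0 -> forall i, a i = 0.
Proof.
move=> pureB s0 i; apply/eqP; apply: contraT => ai0.
have [p p0 vp] := exists_unif.
(* Scaling keeps the sum zero and turns the coefficient at [i] into [p^-1], which is not
   integral. *)
have := @pure_int I B (fun j => (p^-1 / a i) * a j) pureB.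
rewrite (eq_bigr (fun j => (p^-1 / a i) *: (a j *: B j))); last first.
  by move=> j _; rewrite scalerA.
rewrite -scaler_sumr s0 scaler0 val_ge0 => /(_ isT i).
by rewrite divfK // /int_ring val_geE ?invr_eq0 // vvalV // vp.
Qed.

(** Bases are tuples, while the families here are indexed by finite types such as pairs. *)
Definition family_tuple (I : finType) (B : I -> L) : #|I|.-tuple L :=
  [tuple B (enum_val i) | i < #|I|].

Lemma family_tupleE (I : finType) (B : I -> L) (i : 'I_#|I|) :
  (family_tuple B)`_i = B (enum_val i).
Proof. by rewrite -tnth_nth tnth_mktuple. Qed.

Lemma sum_family_tuple (I : finType) (B : I -> L) (a : I -> k) :
  \sum_(i < #|I|) a (enum_val i) *: (family_tuple B)`_i = \sum_i a i *: B i.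
Proof.
rewrite [RHS](reindex (@enum_val I xpredT)) /=; last first.
  by apply: onW_bij; exact: enum_val_bij.
by apply: eq_bigr => i _; rewrite family_tupleE.
Qed.

Lemma pure_free (I : finType) (B : I -> L) : pure_family B -> free (family_tuple B).
Proof.
move=> pureB; apply/freeP => a s0 i.
rewrite -(enum_valK i); apply: (pure_inj (a := a \o enum_rank) pureB).
rewrite -sum_family_tuple -[RHS]s0; apply: eq_bigr => j _.
by rewrite /= enum_valK.
Qed.

Lemma pure_card (I : finType) (B : I -> L) : pure_family B -> (#|I| <= \dim {:L})%N.
Proof.
move=> /pure_free; rewrite /free size_tuple => /eqP <-.
exact/dimvS/subvf.
Qed.

Lemma val_ge_all_eq0 y : (forall c : nat, y \in val_ge w c%:R) -> y = 0.
Proof.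
move=> y_ge; apply/eqP; apply: contraT => y0; have [z wy] := val_discrete y0.
have := y_ge `|z|.+1; rewrite val_geE // wy leNgt.
rewrite ltr_pdivrMr // -natrM; case/negP.
apply: le_lt_trans (_ : z%:~R <= `|z|%:R) _.
  by rewrite pmulrn ler_int abszE ler_norm.
by rewrite ltr_nat mulSn (leq_trans (n := `|z| * E + 1)) ?addn1 ?ltnS ?leq_pmulr //
  -addn1 addnC leq_add2r.
Qed.

(** Successive approximation: the digits of the remainders modulo p give coefficients whose partial
    sums are Cauchy, and completeness of [k] provides their limits. *)
Lemma spans_int (I : finType) (B : I -> L) : (forall i, B i \in int_ring w) ->
    spans_modp B ->
  forall x, x \in int_ring w ->
    exists2 a : I -> k, (forall i, a i \in int_ring v) & x = \sum_i a i *: B i.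
Proof.
move=> OB spanB x0 Ox0; have [p p0 vp] := exists_unif.
have P0 : p%:A != 0 :> L by rewrite alg_neq0.
have w1 : w p%:A = 1 by rewrite vval_alg // vp.
have /choice[digit digitP] : forall x, exists a : I -> k, x \in int_ring w ->
    (forall i, a i \in int_ring v) /\ x - \sum_i a i *: B i \in val_ge w 1.
  move=> x; case: (boolP (x \in int_ring w)) => [/spanB[a Oa xa]|_]; first by exists a.
  by exists (fun=> 0).
pose next x := p%:A^-1 * (x - \sum_i digit x i *: B i).
pose rem m := iter m next x0.
have Orem m : rem m \in int_ring w.
  elim: m => [//|m IHm]; rewrite /rem iterS -/(rem m) /next.
  by rewrite /int_ring -(val_geMl w_val _ _ P0) mulVKf // w1 addr0; case: (digitP _ IHm).
pose s m i := \sum_(l < m) p ^+ l * digit (rem l) i.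
have digO l i : digit (rem l) i \in int_ring v by case: (digitP _ (Orem l)).
have xE m : x0 = \sum_i s m i *: B i + (p ^+ m)%:A * rem m.
  elim: m => [|m IHm].
    rewrite expr0 scale1r mul1r big1 ?add0r // => i _.
    by rewrite /s big_ord0 scale0r.
  have sS : \sum_i s m.+1 i *: B i =
      \sum_i s m i *: B i + (p ^+ m)%:A * \sum_i digit (rem m) i *: B i.
    rewrite mulr_sumr -big_split /=; apply: eq_bigr => i _.
    by rewrite /s big_ord_recr /= scalerDl mulr_algl scalerA.
  rewrite [LHS]IHm sS /rem iterS -/(rem m) /next exprSr.
  rewrite -scalerA -[_ *: p%:A]mulr_algl -mulrA.
  by rewrite mulVKf // mulrBr addrACA subrr addr0.
have s_near m m' i : (m <= m')%N -> s m' i - s m i \in val_ge v m%:Z.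
  move=> /subnK <-; elim: (m' - m)%N => [|d IHd].
    by rewrite subrr val_ge0.
  rewrite addSn /s big_ord_recr /= -/(s _ i) addrAC; apply: val_geD => //.
  rewrite -[X in val_ge v X]addr0; apply: val_geM => //.
  rewrite val_geE ?expf_neq0 // vvalX // vp.
  by rewrite natz lez_nat leq_addl.
have s_cauchy i c : exists N, forall m m', (N <= m)%N -> (N <= m')%N ->
    s m i - s m' i \in val_ge v c.
  exists (absz c) => m m' cm cm'.
  have le_c : c <= absz c by rewrite abszE ler_norm.
  rewrite -(subrK (s (absz c) i) (s m i)) -addrA; apply: (val_ge_trans le_c).
  by apply: val_geD; rewrite ?s_near // -val_geN // opprB s_near.
have /choice[l lP] : forall i, exists l : k, forall c : int, exists N, forall m, (N <= m)%N ->
    s m i - l \in val_ge v c.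
  by move=> i; case: v_local => _ v_cpl _ _; apply: v_cpl; exact: s_cauchy.
exists l => [i|].
  have [N /(_ N (leqnn N)) sN] := lP i 0.
  rewrite -(subKr (s N i) (l i)); apply: val_geB => //.
  rewrite -[s N i]subr0.
  by have := s_near 0 N i (leq0n N); rewrite {2}/s big_ord0.
apply/eqP; rewrite -subr_eq0; apply/eqP/val_ge_all_eq0 => c.
have /choice[N NP] : forall i, exists N, forall m, (N <= m)%N -> s m i - l i \in val_ge v c%:Z.
  by move=> i; exact: lP.
(* One index reaches precision [c] in all coefficients and in the remainder [p ^+ m] times an
   integral element. *)
pose m := (c + \max_i N i)%N.
rewrite (xE m) addrAC -sumrB; apply: val_geD => //.
  apply: val_ge_sum => // i _.
  rewrite -scalerBl -mulr_algl -[X in val_ge w X]addr0; apply: val_geM => //.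
  rewrite (val_ge_alg _ c%:Z) NP // (leq_trans _ (leq_addl _ _)) //.
  exact: leq_bigmax.
rewrite -[X in val_ge w X]addr0; apply: val_geM => //.
rewrite (val_ge_alg _ c%:Z) val_geE ?expf_neq0 // vvalX // vp.
by rewrite natz lez_nat leq_addr.
Qed.

Lemma int_basis (I : finType) (B : I -> L) : (forall i, B i \in int_ring w) ->
    pure_family B -> spans_modp B ->
  basis_of fullv (family_tuple B) /\
  forall x i, x \in int_ring w -> coord (family_tuple B) i x \in int_ring v.
Proof.
move=> OB pureB spanB; have freeB := pure_free pureB.
have [p p0 vp] := exists_unif.
split.
  rewrite basisEfree freeB subvf size_tuple /=.
  suff sub : (fullv <= <<family_tuple B>>)%VS.
    by rewrite (leq_trans (dimvS sub)) // (leq_trans (dim_span _)) ?size_tuple.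
  apply/subvP=> x _; have [->|x0] := eqVneq x 0; first exact: mem0v.
  have [z wx] := val_discrete x0.
  (* This power of [p] makes [x] integral: as [E >= 1], the exponent outweighs [z / E]. *)
  have [] := spans_int OB spanB (x := (p ^+ absz z)%:A * x).
    rewrite /int_ring val_geE ?mulf_neq0 ?alg_neq0 ?expf_neq0 //.
    rewrite vvalM ?alg_neq0 ?expf_neq0 // vval_alg ?expf_neq0 // vvalX // vp wx.
    rewrite -lerBlDr sub0r -mulNr ler_pdivrMr //.
    rewrite natz abszE -rmorphN -[E%:R]/((E%:Z)%:~R) -intrM ler_int.
    apply: le_trans (_ : - z <= `|z|) _; first by rewrite -normrN ler_norm.
    by rewrite ler_peMr // lez_nat.
  move=> a _ /(congr1 (fun y => (p ^+ absz z)^-1 *: y)).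
  rewrite mulr_algl scalerA mulVf ?expf_neq0 // scale1r => ->.
  rewrite memvZ // -sum_family_tuple memv_suml // => i _.
  by rewrite memvZ // memv_span // mem_nth // size_tuple.
move=> x i Ox; have [a Oa ->] := spans_int OB spanB Ox.
by rewrite -sum_family_tuple (coord_sum_free (fun j => a (enum_val j))).
Qed.

(** * Residue bases and the identity n = e f *)

Definition residue_free d (b : 'I_d -> L) := (forall i, b i \in int_ring w) /\
  forall a : 'I_d -> k, (forall i, a i \in int_ring v) ->
    \sum_i a i *: b i \in max_ideal w -> forall i, a i \in max_ideal v.

Definition unif_family d (b : 'I_d -> L) (ij : 'I_d * 'I_E) : L :=
  pi ^+ ij.2 * b ij.1.

Lemma int_ring_piX j : pi ^+ j \in int_ring w.
Proof.
by rewrite /int_ring val_geE ?expf_neq0 // val_piX divr_ge0 // ler0n.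
Qed.

Lemma sum_unif_family d (b : 'I_d -> L) a :
  \sum_ij a ij *: unif_family b ij =
  \sum_(j < E) pi ^+ j * \sum_i a (i, j) *: b i.
Proof.
transitivity (\sum_i \sum_j a (i, j) *: unif_family b (i, j)).
  by rewrite pair_bigA; apply: eq_bigr => -[].
rewrite exchange_big /=; apply: eq_bigr => j _; rewrite mulr_sumr.
by apply: eq_bigr => i _; rewrite /unif_family /= scalerAr.
Qed.

Lemma unif_family_int d (b : 'I_d -> L) ij : (forall i, b i \in int_ring w) ->
  unif_family b ij \in int_ring w.
Proof. by move=> Ob; rewrite int_ringM ?int_ring_piX. Qed.

(** Induction on the exponent of [pi]: terms of smaller exponent already lie in p O_L and those of
    larger exponent have valuation at least [(j + 1) / E]. Dividing by [pi ^+ j] leaves a relation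
    modulo m_L among the [b i]. *)
Lemma residue_free_pure d (b : 'I_d -> L) : residue_free b -> pure_family (unif_family b).
Proof.
move=> [Ob freeb] a Oa; rewrite sum_unif_family => sa.
suff claim l (j : 'I_E) : (j < l)%N -> forall i, a (i, j) \in max_ideal v.
  by move=> [i j]; exact: claim (ltnSn j) i.
elim: l j => // l IHl j; rewrite ltnS leq_eqVlt => /predU1P[jl|]; last exact: IHl.
apply: freeb => [i|]; first exact: Oa.
pose y j := \sum_i a (i, j) *: b i; rewrite -/(y j).
have lE : ((l.+1)%:R / E%:R <= 1 :> rat).
  by rewrite ler_pdivrMr // mul1r ler_nat -jl ltn_ord.
have Oy j' : y j' \in int_ring w by apply: int_ring_comb => // i; exact: Oa.
suff: pi ^+ j * y j \in val_ge w (l.+1%:R / E%:R).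
  rewrite -jl -natr1 mulrDl -val_piX val_geMl ?expf_neq0 //.
  by rewrite max_idealE.
have -> : pi ^+ j * y j =
    \sum_(j' < E) pi ^+ j' * y j' - \sum_(j' < E | j' != j) pi ^+ j' * y j'.
  by rewrite [X in X - _](bigD1 j) //= addrK.
apply: val_geB => //; first exact: val_ge_trans lE sa.
apply: val_ge_sum => // j' j'j; have [lt_j'|le_j'] := ltnP j' l.
  apply: (val_ge_trans lE); rewrite -[X in val_ge w X]add0r.
  apply: val_geM => //; first exact: int_ring_piX.
  apply: val_ge_sum => // i _; rewrite -mulr_algl -[X in val_ge w X]addr0.
  by apply: val_geM => //; rewrite (val_ge_alg _ 1) -max_ideal_int IHl.
have lt_j' : (l < j')%N.
  by rewrite ltn_neqAle le_j' -jl andbT eq_sym.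
rewrite -[X in val_ge w X]addr0; apply: val_geM => //.
by rewrite val_geE ?expf_neq0 // val_piX ler_pM2r ?invr_gt0 // ler_nat.
Qed.

Lemma residue_basis_free d (b : 'I_d -> L) : residue_basis v w b -> residue_free b.
Proof. by case. Qed.

(** A pi-adic expansion with digits in the span of the [b i], cut after [E] digits because [pi ^+ E]
    has valuation 1. *)
Lemma residue_basis_spans d (b : 'I_d -> L) : residue_basis v w b ->
  spans_modp (unif_family b).
Proof.
move=> [Ob spanb _].
have claim l x : x \in int_ring w -> exists2 a : nat -> 'I_d -> k,
    (forall j i, a j i \in int_ring v) &
    x - \sum_(j < l) pi ^+ j * \sum_i a j i *: b i \in val_ge w (l%:R / E%:R).
  elim: l x => [|l IHl] x Ox.
    exists (fun _ _ => 0) => [*|]; first exact: val_ge0.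
    by rewrite big_ord0 subr0 mul0r.
  have [c Oc xc] := spanb x Ox.
  pose y := pi^-1 * (x - \sum_i c i *: b i).
  have xE : x = \sum_i c i *: b i + pi * y by rewrite mulVKf // addrC subrK.
  have /IHl [a Oa ya] : y \in int_ring w.
    rewrite /int_ring -(val_geMl w_val _ _ pi_neq0) mulVKf // val_pi addr0.
    by move: xc; rewrite max_idealE mul1r.
  exists (fun j => if j is j'.+1 then a j' else c) => [[|j] i //|].
  rewrite big_ord_recl /= expr0 mul1r {1}xE addrAC opprD addrA subrr add0r.
  rewrite addrC (eq_bigr (fun j : 'I_l => pi * (pi ^+ j * \sum_i a j i *: b i))).
    by rewrite -mulr_sumr -mulrBr -nat1r mulrDl mul1r -val_pi val_geMl // val_pi.
  by move=> j _; rewrite /= /bump add1n exprS mulrA.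
move=> x /(claim E)[a Oa]; rewrite divff // => xa.
by exists (fun ij : 'I_d * 'I_E => a ij.2 ij.1) => //; rewrite sum_unif_family.
Qed.

Lemma residue_basis_int_basis d (b : 'I_d -> L) : residue_basis v w b ->
  basis_of fullv (family_tuple (unif_family b)) /\
  forall x i, x \in int_ring w ->
    coord (family_tuple (unif_family b)) i x \in int_ring v.
Proof.
move=> bb; have [Ob _ _] := bb; apply: int_basis.
- by move=> ij; exact: unif_family_int.
- exact/residue_free_pure/residue_basis_free.
- exact: residue_basis_spans.
Qed.

Lemma residue_basis_dim d (b : 'I_d -> L) : residue_basis v w b -> (d * E)%N = \dim {:L}.
Proof.
move=> /residue_basis_int_basis[bX _].
by rewrite (size_basis bX) card_prod !card_ord.
Qed.

(** A residue free family is pure, so the dimension bounds its size; one of maximal size must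
    span. *)
Lemma exists_residue_basis : exists d, exists b : 'I_d -> L, residue_basis v w b.
Proof.
pose P d := `[< exists b : 'I_d -> L, residue_free b >].
have exP : exists d, P d.
  exists 0%N; apply/asboolP; exists (fun=> 0).
  by split=> [[]//|a _ _ []].
have maxP d : P d -> (d <= \dim {:L})%N.
  move/asboolP=> [b [Ob freeb]]; rewrite -(card_ord d).
  apply: (@pure_card _ b) => a Oa sa; apply: freeb => //.
  exact: val_ge_gt ltr01 sa.
case: (ex_maxnP exP maxP) => d /asboolP[b [Ob freeb]] max_d.
exists d, b; split=> // x Ox; apply: contrapT => x_nspan.
suff: P d.+1 by move/max_d; rewrite ltnn.
apply/asboolP; exists (fun i => if unlift ord0 i is Some j then b j else x).
split=> [i|a Oa]; first by case: (unlift ord0 i).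
rewrite big_ord_recl unlift_none.
rewrite (eq_bigr (fun i => a (lift ord0 i) *: b i)); last by move=> i _; rewrite liftK.
(* If the coefficient of the adjoined [x] is a unit, dividing by it puts [x] in the span modulo m_L,
   a contradiction. Otherwise its term drops out modulo m_L. *)
move=> sa; have [ma0|ma0] := boolP (a ord0 \in max_ideal v); last first.
  case: x_nspan; have a0 : a ord0 != 0.
    by apply: contraNneq ma0 => ->; rewrite val_gt0.
  have va0 : v (a ord0) = 0.
    apply/eqP; rewrite eq_le; move: ma0 (Oa ord0).
    by rewrite val_gtE // val_geE // -leNgt => -> ->.
  have Oinv : (a ord0)^-1 \in int_ring v.
    by rewrite /int_ring val_geE ?invr_eq0 // vvalV // va0 oppr0.
  exists (fun i => - (a ord0)^-1 * a (lift ord0 i)) => [i|].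
    by apply: int_ringM => //; rewrite /int_ring val_geN.
  rewrite -sumrN (eq_bigr (fun i => (a ord0)^-1 *: (a (lift ord0 i) *: b i))).
    rewrite -scaler_sumr -{1}[x](scalerK a0) -scalerDr -mulr_algl.
    rewrite /max_ideal -[X in val_gt w X]addr0; apply: val_gtM => //.
    by rewrite -[val_ge w 0]/(int_ring w) int_ring_alg.
  by move=> i _; rewrite scalerA mulNr scaleNr opprK.
move=> i; case: (unliftP ord0 i) => [j ->|->//].
apply: (freeb (fun i => a (lift ord0 i))) => //.
move: sa => /(val_gtB w_val) /(_ (_ : a ord0 *: x \in _)).
rewrite addrAC subrr add0r; apply.
rewrite -mulr_algl mulrC /max_ideal -[X in val_gt w X]addr0; apply: val_gtM => //.
by rewrite -[val_gt w 0]/(max_ideal w) max_ideal_alg.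
Qed.

(** All residue bases satisfy the same product formula, so the choice of [xget] is harmless;
    existence excludes its default value [0]. *)
Lemma residue_degreeE : (residue_degree v w * E)%N = \dim {:L}.
Proof.
rewrite /residue_degree; case: xgetP => [d _ [b bb]|none].
  exact: residue_basis_dim bb.
by have [d bb] := exists_residue_basis; case: (none d).
Qed.

(** * The valuation of the norm *)

Lemma det_mulmat_int n (X : n.-tuple L) x : basis_of fullv X -> x \in int_ring w ->
  \det (mulmat X x) \in int_ring v.
Proof.
(* In the basis pi^j b_i of O_L over O, an integral element has an integral matrix. *)
move=> bX Ox; have [d [b bb]] := exists_residue_basis.
have [bY coordY] := residue_basis_int_basis bb.
rewrite (det_mulmat_basis x bX bY); apply: int_ring_det => // i j.
rewrite mxE; apply: coordY; rewrite int_ringM // family_tupleE.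
by case: bb => Ob _ _; exact: unif_family_int.
Qed.

Lemma det_mulmat_neq0 n (X : n.-tuple L) x : basis_of fullv X -> x != 0 ->
  \det (mulmat X x) != 0.
Proof.
move=> bX x0; have /(congr1 determinant) := mulmatM x x^-1 bX.
rewrite mulfV // -[1]scale1r mulmat_alg // det1 det_mulmx.
by apply: contra_eq_neq => ->; rewrite mul0r oner_neq0.
Qed.

(** The norm of a unit and that of its inverse are integral, so both have valuation 0. Up to a unit,
    [x ^+ E] is a power of [p], whose norm is explicit. *)
Lemma val_det_mulmat n (X : n.-tuple L) x : basis_of fullv X -> x != 0 ->
  (v (\det (mulmat X x)))%:~R = n%:R * w x.
Proof.
move=> bX x0; pose D y := \det (mulmat X y).
have DM y z : D (y * z) = D y * D z by rewrite /D mulmatM // det_mulmx.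
have D1 : D 1 = 1 by rewrite /D -[1]scale1r mulmat_alg // det1.
have D0 y : y != 0 -> D y != 0 by exact: det_mulmat_neq0.
have DX y m : D (y ^+ m) = D y ^+ m.
  by elim: m => [|m IHm]; rewrite ?expr0 // !exprS DM IHm.
have unitD u : u != 0 -> w u = 0 -> v (D u) = 0.
  move=> u0 wu; have Du0 := D0 u u0.
  have := det_mulmat_int bX (_ : u^-1 \in int_ring w).
  have := det_mulmat_int bX (_ : u \in int_ring w).
  rewrite /int_ring !(val_geE w) ?invr_eq0 // vvalV // wu oppr0 => /(_ isT) + /(_ isT).
  rewrite -!/(D _) !val_geE ?D0 ?invr_eq0 // => vu.
  have -> : D u^-1 = (D u)^-1 by apply: (mulfI Du0); rewrite -DM !mulfV.
  by rewrite vvalV // oppr_ge0 => uv; apply/eqP; rewrite eq_le vu uv.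
have [p p0 vp] := exists_unif; have [z wx] := val_discrete x0.
have P0 : (p ^ z)%:A != 0 :> L by rewrite alg_neq0 expfz_neq0.
pose u := x ^+ E / (p ^ z)%:A.
have u0 : u != 0 by rewrite mulf_neq0 ?expf_neq0 ?invr_eq0.
have wu : w u = 0.
  rewrite vvalM ?expf_neq0 ?invr_eq0 // vvalX // vvalV // vval_alg ?expfz_neq0 //.
  by rewrite vvalXz // vp intz wx -[_ *+ E]mulr_natr divfK // subrr.
have xE : D x ^+ E = D u * (p ^ z) ^+ n.
  rewrite -DX -[x ^+ E](divfK P0) DM; congr (_ * _).
  by rewrite /D mulmat_alg // det_scalar.
have := congr1 v xE; rewrite vvalM ?D0 ?expf_neq0 ?expfz_neq0 // unitD // add0r.
rewrite !vvalX ?D0 ?expfz_neq0 // vvalXz // vp intz => /(congr1 (intr : int -> rat)).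
rewrite !rmorphMn /= => eqE; apply: (mulIf E_neq0).
by rewrite mulr_natr eqE wx -mulrA divfK // mulr_natl.
Qed.

(** * The codifferent as a power of the maximal ideal *)

Lemma codifferentE d : different v w = max_ideal_exp w d ->
  forall x, codifferent v w x <-> x \in val_ge w (- d%:R / E%:R).
Proof.
move=> diffE.
have {}diffE y : different v w y <-> y \in val_ge w (d%:R / E%:R).
  by rewrite diffE; exact: max_ideal_expE.
move=> x; split=> [Cx|].
  have /diffE/(_ x Cx) : pi ^+ d \in val_ge w (d%:R / E%:R).
    by rewrite val_geE ?expf_neq0 // val_piX.
  have [-> _|x0] := eqVneq x 0; first exact: val_ge0.
  rewrite /int_ring !val_geE ?mulf_neq0 ?expf_neq0 // vvalM ?expf_neq0 // val_piX.
  by rewrite -lerBlDr sub0r mulNr.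
(* Since [pi ^ (d - 1)] is not in the different, the codifferent has an element of valuation at most
   [- d / E], whose integral multiples fill the rest. The exponent is an integer, as [d] may be
   [0]. *)
have [x1 Cx1 x1_small] : exists2 x1, codifferent v w x1 &
    x1 \notin val_ge w ((1 - d%:Z)%:~R / E%:R).
  apply: contrapT => C_large.
  have /diffE : different v w (pi ^ (d%:Z - 1)).
    move=> y Cy; have y_ge : y \in val_ge w ((1 - d%:Z)%:~R / E%:R).
      by apply: contraT => ny; case: C_large; exists y.
    have [->|y0] := eqVneq y 0; first by rewrite mul0r val_ge0.
    move: y_ge; rewrite /int_ring !val_geE ?mulf_neq0 ?expfz_neq0 //.
    rewrite vvalM ?expfz_neq0 // val_piXz -opprB rmorphN mulNr => h.
    by rewrite -lerBlDr sub0r.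
  rewrite val_geE ?expfz_neq0 // val_piXz ler_pM2r ?invr_gt0 //.
  by rewrite -[d%:R]/(d%:Z%:~R) ler_int lerDl oppr_ge0.
have x1_neq0 : x1 != 0 by apply: contraNneq x1_small => ->; rewrite val_ge0.
have w_x1 : w x1 <= - d%:R / E%:R.
  move: x1_small; rewrite val_geE //; have [z ->] := val_discrete x1_neq0.
  rewrite -ltNge ltr_pM2r ?invr_gt0 // ltr_int => lt_z.
  rewrite ler_pM2r ?invr_gt0 // -[d%:R]/(d%:Z%:~R) -rmorphN ler_int.
  by rewrite -ltzD1 addrC.
move=> x_ge y Oy; rewrite -(divfK x1_neq0 x) mulrAC mulrC; apply: Cx1.
apply: int_ringM => //; have [->|x0] := eqVneq x 0; first by rewrite mul0r val_ge0.
move: x_ge; rewrite /int_ring !val_geE ?mulf_neq0 ?invr_eq0 //.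
rewrite vvalM ?invr_eq0 // vvalV // subr_ge0; exact: le_trans.
Qed.

Lemma polyOver_intP (g : {poly k}) :
  reflect (forall i, g`_i \in int_ring v) (g \is a polyOver (int_ring v)).
Proof.
apply: (iffP (all_nthP 0)) => [Og i|Og i _]; last exact: Og.
by have [/Og //|?] := ltnP i (size g); rewrite nth_default ?val_ge0.
Qed.

(** * Values of monic polynomials at theta and the invariant mu *)

Section Okutsu.
Variables (F : {poly k}) (m : nat) (theta : L).
Hypotheses (F_int : F \is a polyOver (int_ring v)) (F_monic : F \is monic).
Hypotheses (F_irr : irreducible_poly F) (F_sep : separable_poly F).
Hypothesis size_F : size F = m.+2.
Hypothesis F_theta : root (map_poly (in_alg L) F) theta.
Hypothesis theta_gen : <<1%AS; theta>>%VS = fullv.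

Local Notation ev p := (map_poly (in_alg L) p).[theta].
Local Notation tau := (top_coord m theta).

(** If [w theta] were negative, the leading term of the equation would have smaller valuation than
    all the others. *)
Lemma root_int : theta \in int_ring w.
Proof.
have [->|th0] := eqVneq theta 0; first exact: val_ge0.
have [th_ge0|th_lt0] := leP 0 (w theta); first by rewrite /int_ring val_geE.
have thS : theta ^+ m.+1 = - \sum_(i < m.+1) F`_i *: theta ^+ i.
  apply/eqP; rewrite -addr_eq0; have /rootP := F_theta.
  rewrite (@horner_coef_wide _ m.+2) ?size_map_poly ?size_F // => /eqP.
  rewrite big_ord_recr /= addrC coef_map /= mulr_algl.
  move: (monicP F_monic); rewrite lead_coefE size_F /= => ->; rewrite scale1r.
  by congr (_ + _ == 0); apply: eq_bigr => i _; rewrite coef_map mulr_algl.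
have : theta ^+ m.+1 \in val_ge w (w theta *+ m).
  rewrite thS val_geN //; apply: val_ge_sum => // i _.
  rewrite -mulr_algl -[X in val_ge w X]add0r; apply: val_geM => //.
    by have := int_ring_alg F`_i; rewrite (polyOver_intP _ F_int).
  by rewrite val_geE ?expf_neq0 // vvalX // ler_nMn2l // -ltnS.
by rewrite val_geE ?expf_neq0 // vvalX // ler_nMn2l // ltnn.
Qed.

Lemma ev_int g : g \is a polyOver (int_ring v) -> ev g \in int_ring w.
Proof.
move=> /polyOver_intP Og; rewrite horner_coef; apply: val_ge_sum => // i _.
by rewrite int_ringM ?int_ringX ?root_int // coef_map int_ring_alg.
Qed.

Lemma deriv_root_neq0 : ev F^`() != 0.
Proof.
rewrite -rootE; apply: (coprimep_root _ F_theta).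
by rewrite coprimep_map; move: F_sep; rewrite unlock.
Qed.

Variable rho : nat.
Hypothesis differentE : different v w = max_ideal_exp w (E - 1 + rho).

Let a := ev F^`().
Let r : rat := E%:R^-1.
(** With these notations the exponent of the different, divided by [E], is [1 - r + s]. *)
Let s : rat := rho%:R * r.

Let codiffE x : codifferent v w x <-> x \in val_ge w (r - 1 - s).
Proof.
have -> : r - 1 - s = - (E - 1 + rho)%:R / E%:R.
  by rewrite natrD natrB // -/r mulNr !mulrDl mulNr mul1r divff // -/s; lra.
exact: codifferentE.
Qed.

Let r_le1 : r <= 1.
Proof. by rewrite invf_le1 // ler1n. Qed.

Lemma val_top_coord1 x : tau x = 1 -> w x <= w a - s.
Proof.
move=> tau1; have [p p0 vp] := exists_unif; have a0 := deriv_root_neq0.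
have x0 : x != 0.
  by apply: contra_eq_neq tau1 => ->; rewrite /top_coord linear0 eq_sym oner_neq0.
rewrite leNgt; apply/negP => lt_x.
(* Both valuations lie in (1/E)Z, so strictness gains a full step [r]: exactly what puts [x / (p a)]
   in the codifferent. *)
have : x \in val_ge w (w a - s + r).
  have [z wa] := val_discrete a0.
  have := val_gt_discrete (z - rho%:Z) x.
  rewrite rmorphB rmorphD rmorphB /= !mulrDl -wa !mulNr -/r -/s mul1r.
  by move=> <-; rewrite val_gtE.
rewrite val_geE // => ge_x.
pose y := p^-1 *: (x / a).
have y0 : y != 0 by rewrite scaler_eq0 !mulf_eq0 !invr_eq0 (negPf p0) (negPf x0) (negPf a0).
have Cy : codifferent v w y.
  apply/codiffE; rewrite val_geE // vvalZ ?invr_eq0 ?mulf_neq0 ?invr_eq0 //.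
  by rewrite (vvalV v_val) // vp (vvalM w_val) ?invr_eq0 // (vvalV w_val) //; lra.
have := Cy 1 (int_ring1 w_val).
rewrite mulr1 (trace_top_coord F_monic F_irr size_F F_theta theta_gen).
rewrite -scalerAl divfK // top_coordZ tau1 mulr1 /int_ring.
by rewrite val_geE ?invr_eq0 // vvalV // vp.
Qed.

Lemma exists_optimal : exists g : {poly k},
  [/\ g \is monic, g \is a polyOver (int_ring v), size g = m.+1
    & w (ev g) = w a - s].
Proof.
have [p p0 vp] := exists_unif; have a0 := deriv_root_neq0.
have trE y : field_trace y = tau (y * a).
  exact: (trace_top_coord F_monic F_irr size_F F_theta theta_gen).
(* The valuation [- 1 - s] is one step [r] below the bound of the codifferent. *)
pose z := pi ^ (- (E + rho)%:Z).
have z0 : z != 0 by rewrite expfz_neq0.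
have wz : w z = - 1 - s.
  by rewrite val_piXz rmorphN /= -pmulrn natrD mulNr mulrDl divff // -/s opprD.
have r_gt0 : 0 < r by rewrite invr_gt0.
have [y Oy Tr_zy] : exists2 y, y \in int_ring w & field_trace (z * y) \notin int_ring v.
  apply: contrapT => no_y.
  have /codiffE : codifferent v w z.
    by move=> y Oy; apply: contraT => ny; case: no_y; exists y.
  by rewrite val_geE // wz; apply/negP; rewrite -ltNge; lra.
(* The factor [p] brings [z * y] back into the codifferent because [r <= 1]. It raises the valuation
   of a non-integral trace by only 1, so [u] is a unit. *)
pose x1 := p *: (z * y * a).
have tau_x1 t : t \in int_ring w -> tau (x1 * t) \in int_ring v.
  move=> Ot; have -> : x1 * t = (p *: (z * y)) * t * a.
    by rewrite /x1 -!scalerAl mulrAC.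
  rewrite -trE; have C1 : codifferent v w (p *: (z * y)); last exact: C1.
  apply/codiffE; have [->|y0] := eqVneq y 0; first by rewrite mulr0 scaler0 val_ge0.
  move: Oy; rewrite /int_ring !val_geE ?scaler_eq0 ?negb_or ?p0 ?mulf_neq0 //.
  by rewrite vvalZ ?mulf_neq0 // (vvalM w_val) // vp wz; have := r_le1; lra.
pose u := tau x1.
have uE : u = p * field_trace (z * y) by rewrite /u top_coordZ trE.
have Tr0 : field_trace (z * y) != 0.
  by apply: contraNneq Tr_zy => ->; rewrite val_ge0.
have u0 : u != 0 by rewrite uE mulf_neq0.
have vu : v u = 0.
  apply/eqP; rewrite eq_le; apply/andP; split; last first.
    by have := tau_x1 1 (int_ring1 w_val); rewrite mulr1 -/u /int_ring val_geE.
  move: Tr_zy; rewrite uE (vvalM v_val) // vp /int_ring val_geE // -ltNge -lezD1.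
  by rewrite addrC.
have y0 : y != 0.
  by apply: contraNneq Tr_zy => ->; rewrite mulr0 trE mul0r /top_coord linear0 val_ge0.
pose x0 := u^-1 *: x1.
have tau_x0 : tau x0 = 1 by rewrite top_coordZ mulVf.
have [g size_g Dx0] := ev_surj F_monic size_F F_theta theta_gen x0.
have coordg := coord_ev F_monic F_irr size_F F_theta theta_gen.
have gE (j : 'I_m.+1) : g`_j = coord (powers m theta) j x0.
  by rewrite Dx0 coordg.
have g_m : g`_m = 1 by rewrite -tau_x0 /top_coord -gE.
have g_size : size g = m.+1.
  apply/eqP; rewrite eqn_leq size_g ltnNge; apply/negP => le_g.
  by move/eqP: g_m; rewrite nth_default // eq_sym oner_eq0.
exists g; split=> //.
- by apply/monicP; rewrite lead_coefE g_size.
- apply/polyOver_intP => j; have [j_lt|] := ltnP j m.+1; last first.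
    by move=> ?; rewrite nth_default ?val_ge0 // g_size.
  (* By duality the coefficient is, up to the unit [u], the value of tau at [x1] times an element of
     O[theta]. *)
  rewrite (gE (Ordinal j_lt)) linearZ /= int_ringM //.
    by rewrite /int_ring val_geE ?invr_eq0 // (vvalV v_val) // vu oppr0.
  rewrite (coord_dual F_monic F_irr size_F F_theta theta_gen) tau_x1 // ev_int //.
  by apply/polyOver_intP => i; rewrite coef_drop_poly (polyOver_intP _ F_int).
(* The upper bound comes from tau = 1. Conversely the valuation is [1 + (- 1 - s) + w y + w a], with
   [w y >= 0]. *)
rewrite -Dx0; apply/eqP; rewrite eq_le val_top_coord1 //=.
rewrite vvalZ ?invr_eq0 // ?scaler_eq0 ?negb_or ?p0 ?mulf_neq0 //.
rewrite (vvalV v_val) // vu vvalZ ?mulf_neq0 // vp !(vvalM w_val) ?mulf_neq0 // wz.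
by move: Oy; rewrite /int_ring val_geE //; lra.
Qed.

Lemma okutsu_muE : okutsu_mu v w F theta = w a - s.
Proof.
have [g [g_monic g_int g_size wg]] := exists_optimal.
have vals_le h : h \is monic -> h \is a polyOver (int_ring v) ->
    (size h < size F)%N -> w (ev h) <= w a - s.
  move=> h_monic h_int; rewrite size_F ltnS => size_h.
  have h_gt0 : (0 < size h)%N by rewrite size_poly_gt0 monic_neq0.
  pose l := (m.+1 - size h)%N.
  have size_Xh : size ('X^l * h) = m.+1.
    by rewrite size_monicM ?monicXn ?monic_neq0 // size_polyXn addSn /= subnK.
  have tau1 : tau (ev ('X^l * h)) = 1.
    rewrite (top_coord_ev F_monic F_irr size_F F_theta theta_gen) ?size_Xh //.
    have /monicP : 'X^l * h \is monic by rewrite monicMl ?monicXn.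
    by rewrite lead_coefE size_Xh.
  have := val_top_coord1 tau1.
  have : ev ('X^l * h) != 0.
    by apply: contra_eq_neq tau1 => ->; rewrite /top_coord linear0 eq_sym oner_neq0.
  rewrite (evM theta) /= map_polyXn hornerXn mulf_eq0 negb_or => /andP[thl0 evh0].
  rewrite vvalM //; apply: le_trans; rewrite lerDr.
  by have := int_ringX w_val l root_int; rewrite /int_ring val_geE.
apply: xget_unique.
  split; first by exists g; split; rewrite ?g_size ?size_F.
  by move=> _ [h [h_monic h_int size_h ->]]; exact: vals_le.
move=> c [[h [h_monic h_int size_h ->]] max_c].
apply/eqP; rewrite eq_le vals_le //= -wg; apply: max_c.
by exists g; split; rewrite ?g_size ?size_F.
Qed.

End Okutsu.

End Extension.

Theorem theorem1p7
  (k : fieldType) (v : k -> int) (hk : local_field v)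
  (F : {poly k}) (n : nat)
  (hFO : F \is a polyOver (int_ring v))
  (hFmonic : F \is monic)
  (hFirr : irreducible_poly F)
  (hFsep : separable_poly F)
  (hFdeg : size F = n.+1)
  (L : fieldExtType k) (theta : L)
  (htheta : root (map_poly (in_alg L) F) theta)
  (hL : <<1%AS; theta>>%VS = fullv)
  (w : L -> rat) (hw : extends_valuation v w)
  (rho : nat) :
  let e := ramification_index v w in
  let f := residue_degree v w in
  let mu := okutsu_mu v w F theta in
  different v w = max_ideal_exp w (e - 1 + rho) ->
  (v (disc F))%:~R = f%:R * (e%:R * mu + rho%:R) /\
  f%:R * (e%:R * mu + rho%:R) = n%:R * mu + f%:R * rho%:R.
Proof.
move=> e f mu; have [E [pi [E_gt0 pi0 wpi w_discr]]] := exists_unif_ext hk hw.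
have eE : e = E := ramification_indexE hk hw E_gt0 pi0 wpi w_discr.
(* Irreducibility excludes degree 0. *)
case: n hFdeg => [|m] size_F; first by case: hFirr; rewrite size_F.
have bX := powers_basis hFmonic hFirr size_F htheta hL.
have nE : m.+1 = (f * E)%N.
  by rewrite (residue_degreeE hk hw E_gt0 pi0 wpi w_discr) (size_basis bX).
rewrite eE => diffE.
have muE := okutsu_muE hk hw E_gt0 pi0 wpi w_discr hFO hFmonic hFirr hFsep size_F
  htheta hL diffE.
have a0 := deriv_root_neq0 hFsep htheta.
have E0 : E%:R != 0 :> rat by rewrite pnatr_eq0 -lt0n.
have [v_val _ _ _] := hk.
(* The sign has valuation 0 and the resultant is the norm of F'(theta). *)
have vdisc : (v (disc F))%:~R =
    m.+1%:R * w (map_poly (in_alg L) F^`()).[theta] :> rat.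
  have res := resultant_mulmat hFmonic hFirr size_F htheta hL F^`().
  have res0 : resultant F^`() F != 0 by rewrite res (det_mulmat_neq0 bX).
  rewrite /disc (vvalM v_val) ?expf_neq0 ?oppr_eq0 ?oner_neq0 //.
  rewrite (vvalX v_val) ?oppr_eq0 ?oner_neq0 // (vvalN v_val) (vval1 v_val) mul0rn add0r.
  by rewrite res (val_det_mulmat hk hw E_gt0 pi0 wpi w_discr bX).
have ef : f%:R * E%:R = m.+1%:R :> rat by rewrite nE natrM.
split; last by rewrite mulrDr mulrA ef.
by rewrite vdisc /mu muE -ef mulrBr mulrCA mulfV // mulr1 subrK mulrA.
Qed.
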